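(* Let $\mathfrak g$ be a Lie algebra over $\mathbb K$ with a fixed Euler operator $E$ and associated $3$-grading $\mathfrak g=\mathfrak g_1\oplus\mathfrak g_0\oplus\mathfrak g_{-1}$, and let $V^+=\mathfrak g_1$. Let $g\in\mathrm{Aut}(\mathfrak g)$ and $x\in V^+$. Then $g.x\in V^+$ if and only if $d_g(x)$ and $c_g(x)$ are invertible, and then the value $g.x\in V^+$ is given by $$g.x=d_g(x)^{-1}n_g(x).$$ Written explicitly with $g$ replaced by $g^{-1}$: if $g^{-1}.x\in V^+$, then $$g^{-1}.x=\Big(g_{11}-\mathrm{ad}(x)\circ g_{01}+\tfrac12\mathrm{ad}(x)^2\circ g_{-1,1}\Big)^{-1}\Big(g_{10}-\mathrm{ad}(x)\circ g_{00}+\tfrac12\mathrm{ad}(x)^2\circ g_{-1,0}\Big)(E).$$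
   Context: $\mathbb K$ is a commutative ring with unit in which $2$ and $3$ are invertible. An Euler operator is $E\in\mathfrak g$ with $\mathrm{ad}(E)^3=\mathrm{ad}(E)$; its $3$-grading is $\mathfrak g=\mathfrak g_1\oplus\mathfrak g_0\oplus\mathfrak g_{-1}$ with $\mathfrak g_i=\{X:[E,X]=iX\}$. Let $\mathfrak f^-$ be the flag $\mathfrak g_{-1}\subset\mathfrak g_0\oplus\mathfrak g_{-1}$ of submodules of $\mathfrak g$; automorphisms of $\mathfrak g$ act on flags. For $x\in\mathfrak g_{1}$, $e^{\mathrm{ad}\,x}=1+\mathrm{ad}\,x+\frac12(\mathrm{ad}\,x)^2\in\mathrm{Aut}(\mathfrak g)$. The map $x\mapsto e^{\mathrm{ad}\,x}.\mathfrak f^-$ is injective on $\mathfrak g_1$ and one identifies $V^+=\mathfrak g_1$ with the set of flags $\{e^{\mathrm{ad}\,x}.\mathfrak f^-:x\in\mathfrak g_1\}$. Accordingly, for $x\in V^+$, $g.x$ denotes the flag $g\,e^{\mathrm{ad}\,x}.\mathfrak f^-$; ''$g.x\in V^+$'' means that this flag equals $e^{\mathrm{ad}\,z}.\mathfrak f^-$ for some $z\in\mathfrak g_1$, and then $g.x$ also denotes this (unique) $z$. For $g\in\mathrm{Aut}(\mathfrak g)$ put $g_{ij}=\mathrm{pr}_i\circ g\circ\iota_j:\mathfrak g_j\to\mathfrak g_i$ ($\iota_j$ inclusion, $\mathrm{pr}_i$ projection for the grading). Denominator, co-denominator and nominator of $g$ are, for $x\in\mathfrak g_1$, $d_g(x)=(e^{-\mathrm{ad}(x)}g^{-1})_{11}\in\mathrm{End}(\mathfrak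 g_1)$, $c_g(x)=(g\,e^{\mathrm{ad}(x)})_{-1,-1}\in\mathrm{End}(\mathfrak g_{-1})$, $n_g(x)=\mathrm{pr}_1(e^{-\mathrm{ad}(x)}g^{-1}E)\in\mathfrak g_1$. *)

(* Defs.v *)
From HB Require Import structures.
From mathcomp Require Import all_boot all_order all_algebra.
From mathcomp Require Import boolp classical_sets.

Set Implicit Arguments.
Unset Strict Implicit.
Unset Printing Implicit Defensive.

Import GRing.Theory.
Local Open Scope ring_scope.

HB.mixin Record Lmodule_isLie (K : comPzRingType) (L : Type)
    of GRing.Lmodule K L := {
  lie : L -> L -> L;
  lie_linearl : forall y : L, linear (lie^~ y);
  lie_linearr : forall x : L, linear (lie x);
  liexx : forall x : L, lie x x = 0;
  lie_jacobi : forall x y z : L,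
    lie x (lie y z) + lie y (lie z x) + lie z (lie x y) = 0
}.

#[short(type="lieAlgType")]
HB.structure Definition LieAlgebra (K : comPzRingType) :=
  {L of GRing.Lmodule K L & Lmodule_isLie K L}.

Definition ad (K : comPzRingType) (L : lieAlgType K) (x : L) : L -> L := lie x.

HB.instance Definition _ (K : comPzRingType) (L : lieAlgType K) (x : L) :=
  GRing.isLinear.Build K L L *:%R (ad x) (lie_linearr x).

Record lieAut (K : comPzRingType) (L : lieAlgType K) := LieAut {
  aut_fun :> {linear L -> L};
  aut_inv_fun : {linear L -> L};
  aut_funK : cancel aut_fun aut_inv_fun;
  aut_inv_funK : cancel aut_inv_fun aut_fun;
  aut_lie : forall x y : L, aut_fun (lie x y) = lie (aut_fun x) (aut_fun y)
}.

Section LieTheory.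
Variables (K : comPzRingType) (L : lieAlgType K).
Implicit Types x y z : L.

Lemma lieN x y : lie x y = - lie y x.
Proof.
have DL a b c : lie (a + b) c = lie a c + lie b c :> L.
  by have := lie_linearl c 1 a b; rewrite !scale1r.
have := liexx (x + y).
rewrite DL -[lie x _]/(ad x _) -[lie y (x + y)]/(ad y _) !raddfD /=.
by rewrite /ad !liexx add0r addr0 => /eqP; rewrite addr_eq0 => /eqP.
Qed.

Lemma lie_der x y z : lie x (lie y z) = lie (lie x y) z + lie y (lie x z).
Proof.
apply/eqP; rewrite -subr_eq0; apply/eqP.
rewrite -[RHS](lie_jacobi x y z) opprD addrA addrAC; congr (_ + _ + _).
  by rewrite (lieN z x) -[lie y (- _)]/(ad y _) raddfN.
by rewrite (lieN (lie x y)) opprK.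
Qed.

Lemma aut_inv_lie (g : lieAut L) x y :
  aut_inv_fun g (lie x y) = lie (aut_inv_fun g x) (aut_inv_fun g y).
Proof.
by apply: (can_inj (aut_funK g)); rewrite aut_lie !aut_inv_funK.
Qed.

Definition lieAut_inv (g : lieAut L) : lieAut L :=
  LieAut (aut_inv_funK g) (aut_funK g) (aut_inv_lie g).

End LieTheory.

Definition is_inverse (K : comPzRingType) (U : lmodType K)
    (f f' : {linear U -> U}) : Prop :=
  cancel f f' /\ cancel f' f.

Definition invertible (K : comPzRingType) (U : lmodType K)
    (f : {linear U -> U}) : Prop :=
  exists f' : {linear U -> U}, is_inverse f f'.

Definition euler_operator (K : comPzRingType) (L : lieAlgType K) (E : L) :=
  forall X : L, ad E (ad E (ad E X)) = ad E X.

(* The three degrees 1, 0, -1 of a 3-grading. *)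
Inductive degree := P1 | Z0 | M1.

Definition int_of_degree (i : degree) : int :=
  match i with P1 => 1 | Z0 => 0 | M1 => -1 end.

Definition grade_pred (K : comPzRingType) (L : lieAlgType K) (E : L)
    (i : degree) : {pred L} :=
  fun X => lie E X == X *~ int_of_degree i.

Section Grade.
Variables (K : comPzRingType) (L : lieAlgType K) (E : L) (i : degree).

Lemma grade_submod_closed : submod_closed (grade_pred E i).
Proof.
split=> [|a u v].
  by rewrite unfold_in /grade_pred -[lie E 0]/(ad E 0) raddf0 mul0rz.
rewrite !unfold_in /grade_pred => /eqP hu /eqP hv; apply/eqP.
by rewrite lie_linearr hu hv mulrzDl scalerMzr.
Qed.

HB.instance Definition _ :=
  GRing.isSubmodClosed.Build K L (grade_pred E i) grade_submod_closed.

Definition grade : Type := {X : L | X \in grade_pred E i}.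
HB.instance Definition _ := SubType.copy grade {X : L | X \in grade_pred E i}.
HB.instance Definition _ := [Choice of grade by <:].
HB.instance Definition _ := [SubChoice_isSubLmodule of grade by <:].

Lemma gradeE (X : L) : X \in grade_pred E i -> lie E X = X *~ int_of_degree i.
Proof. by move/eqP. Qed.

End Grade.

(* g_1 is the space V^+ of the Jordan pair. *)
Notation Vplus E := (grade E P1).

(* [half] stands for the inverse of 2 in K.  Working with an explicit inverse
   keeps K an arbitrary commutative ring, possibly the zero ring. *)
Section Grading.
Variables (K : comPzRingType) (half : K) (L : lieAlgType K) (E : L).
Hypothesis hE : euler_operator E.

(* Since ad E acts on g_i as the scalar i, the projections of the grading are
   polynomials in ad E; [projE] and [sum_proj] below characterise them. *)
Definition proj_fun (i : degree) (X : L) : L :=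
  match i with
  | P1 => half *: (ad E (ad E X) + ad E X)
  | Z0 => X - ad E (ad E X)
  | M1 => half *: (ad E (ad E X) - ad E X)
  end.

Lemma proj_in (i : degree) (X : L) : proj_fun i X \in grade_pred E i.
Proof.
rewrite unfold_in /grade_pred -[lie E _]/(ad E _); apply/eqP.
case: i => /=.
- by rewrite linearZ raddfD /= hE addrC.
- by rewrite raddfB /= hE subrr.
- by rewrite linearZ raddfB /= hE mulrN1z -scalerN opprB.
Qed.

Definition proj (i : degree) (X : L) : grade E i :=
  Sub (proj_fun i X) (proj_in i X).

Lemma proj_linear (i : degree) : linear (proj i).
Proof.
move=> a u v; apply: val_inj; rewrite [RHS]linearP /=.
case: i => /=.
- exact: (linearP (half \*: ((ad E \o ad E) \+ ad E))).
- exact: (linearP (idfun \- (ad E \o ad E))).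
- exact: (linearP (half \*: ((ad E \o ad E) \- ad E))).
Qed.
HB.instance Definition _ (i : degree) :=
  GRing.isLinear.Build K L (grade E i) *:%R (proj i) (proj_linear i).

Lemma projE (h2 : half * 2%:R = 1) (i j : degree) (X : grade E j) :
  val (proj i (val X)) =
  match i, j with P1, P1 | Z0, Z0 | M1, M1 => val X | _, _ => 0 end.
Proof.
have hX : ad E (val X) = val X *~ int_of_degree j by apply: gradeE (valP X).
have half1 (Y : L) : half *: (Y + Y) = Y.
  by rewrite -mulr2n -scaler_nat scalerA h2 scale1r.
move: hX; case: i; case: j X => X /= hX; rewrite !(hX, raddf0, raddfN) ?mulrN1z;
  rewrite ?mulr1z ?mulr0z ?raddf0 ?raddfN /= ?hX ?mulrN1z ?opprK;
  by rewrite ?half1 ?addrN ?addNr ?subrr ?addr0 ?subr0 ?scaler0.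
Qed.

Lemma sum_proj (h2 : half * 2%:R = 1) (X : L) :
  val (proj P1 X) + val (proj Z0 X) + val (proj M1 X) = X.
Proof.
rewrite /= addrAC -scalerDr addrACA subrr addr0 -mulr2n -scaler_nat scalerA h2.
by rewrite scale1r addrC subrK.
Qed.

(* f_{ij} = pr_i o f o iota_j *)
Definition component (i j : degree) (f : {linear L -> L}) :
    {linear grade E j -> grade E i} :=
  proj i \o f \o val.

End Grading.

Section AdRestriction.
Variables (K : comPzRingType) (L : lieAlgType K) (E : L).

Lemma lie_grade (i j k : degree) (x : grade E i) (y : grade E j) :
  int_of_degree k = int_of_degree i + int_of_degree j ->
  lie (val x) (val y) \in grade_pred E k.
Proof.
move=> hk; rewrite unfold_in /grade_pred lie_der.
rewrite (gradeE (valP x)) (gradeE (valP y)) hk mulrzDr.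
rewrite -[lie (val x) (_ *~ _)]/(ad (val x) _) raddfMz /=.
by rewrite lieN -[lie (val y) _]/(ad _ _) raddfMz /= /ad -mulNrz -lieN.
Qed.

(* ad(x) : g_0 -> g_1 and ad(x) : g_{-1} -> g_0, for x in g_1. *)
Definition ad_0to1 (x : Vplus E) (y : grade E Z0) : grade E P1 :=
  Sub (lie (val x) (val y)) (@lie_grade P1 Z0 P1 x y erefl).

Definition ad_m1to0 (x : Vplus E) (y : grade E M1) : grade E Z0 :=
  Sub (lie (val x) (val y)) (@lie_grade P1 M1 Z0 x y erefl).

Lemma ad_0to1_linear (x : Vplus E) : linear (ad_0to1 x).
Proof.
by move=> a u v; apply: val_inj; rewrite [RHS]linearP /= lie_linearr.
Qed.
HB.instance Definition _ (x : Vplus E) :=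
  GRing.isLinear.Build K (grade E Z0) (grade E P1) *:%R (ad_0to1 x)
    (ad_0to1_linear x).

Lemma ad_m1to0_linear (x : Vplus E) : linear (ad_m1to0 x).
Proof.
by move=> a u v; apply: val_inj; rewrite [RHS]linearP /= lie_linearr.
Qed.
HB.instance Definition _ (x : Vplus E) :=
  GRing.isLinear.Build K (grade E M1) (grade E Z0) *:%R (ad_m1to0 x)
    (ad_m1to0_linear x).

Lemma euler_in_g0 : E \in grade_pred E Z0.
Proof. by rewrite unfold_in /grade_pred liexx mulr0z. Qed.

(* E, viewed as an element of g_0. *)
Definition euler0 : grade E Z0 := Sub E euler_in_g0.

End AdRestriction.

Section Flags.
Variables (K : comPzRingType) (half : K) (L : lieAlgType K) (E : L).

(* e^{ad x}, truncated at order 2; it is an automorphism for x in g_1, but its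
   action on flags only uses that it is linear. *)
Definition expad (x : L) : {linear L -> L} :=
  idfun \+ ad x \+ half \*: (ad x \o ad x).

(* A flag is encoded by its pair of underlying sets, smaller one first. *)
Definition flag : Type := (set L * set L)%type.

Definition flag_act (f : {linear L -> L}) (F : flag) : flag :=
  ((f @` F.1)%classic, (f @` F.2)%classic).

Definition flag_minus : flag :=
  ([set X | X \in grade_pred E M1]%classic,
   [set X + Y | X in [set X | X \in grade_pred E Z0]
              & Y in [set Y | Y \in grade_pred E M1]]%classic).

(* The flag g.x, for x in V^+. *)
Definition moved_flag (g : lieAut L) (x : Vplus E) : flag :=
  flag_act g (flag_act (expad (val x)) flag_minus).

(* g.x = z, where z in V^+ is identified with the flag e^{ad z}.f^-. *)
Definition moves_to (g : lieAut L) (x z : Vplus E) : Prop :=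
  moved_flag g x = flag_act (expad (val z)) flag_minus.

Definition in_Vplus (g : lieAut L) (x : Vplus E) : Prop :=
  exists z : Vplus E, moves_to g x z.

End Flags.

Section Denominators.
Variables (K : comPzRingType) (half : K) (L : lieAlgType K) (E : L).
Hypothesis hE : euler_operator E.

Definition denominator (g : lieAut L) (x : Vplus E) :
    {linear grade E P1 -> grade E P1} :=
  component half hE P1 P1 (expad half (- val x) \o lieAut_inv g).

Definition codenominator (g : lieAut L) (x : Vplus E) :
    {linear grade E M1 -> grade E M1} :=
  component half hE M1 M1 (g \o expad half (val x)).

Definition nominator (g : lieAut L) (x : Vplus E) : grade E P1 :=
  proj half hE P1 (expad half (- val x) (lieAut_inv g E)).

End Denominators.

(* Main.v *)
Require Import Defs.
From mathcomp Require Import all_boot all_order all_algebra.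
From mathcomp Require Import boolp classical_sets.

Set Implicit Arguments.
Unset Strict Implicit.
Unset Printing Implicit Defensive.

Import GRing.Theory.
Local Open Scope ring_scope.

(** Put [p = g_0 + g_{-1}], and for [z] in [g_1] let [k = e^{-z} g e^x].  Then
    [g.x = z] says exactly that [k] stabilizes the flag [g_{-1} < p]
    ([moves_toP]).  Since [e^z] is unipotent upper triangular for the grading,
    replacing [g e^x] by [k] changes neither block involved in the statement:
    [(k^{-1})_{11} = d_g(x)] and [k_{-1,-1} = c_g(x)], whatever [z] is
    ([denominator_normalized], [codenominator_normalized]).  Moreover
    [e^z E = E - z], so that [pr_1 (k^{-1} E) = n_g(x) - d_g(x) z]
    ([nominator_normalized]).

    If [k] stabilizes the flag, both [k] and [k^{-1}] are block lower triangular,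
    so their diagonal blocks are mutually inverse; and [k^{-1} E] lies in [p], so
    [n_g(x) = d_g(x) z].  This gives invertibility and the formula
    ([moves_to_value]).

    Conversely let [d_g(x)] and [c_g(x)] be invertible and take
    [z = d_g(x)^{-1} n_g(x)], so that [k^{-1} E] lies in [p].  From this single
    vector one recovers the whole flag, because the pieces of the grading are
    eigenspaces of [E], and [k], [k^{-1}] turn them into eigenspaces of [k E],
    [k^{-1} E].  The denominator gives the stability of [p]
    ([parabolic_stable], [parabolic_stable_inv]), and then the co-denominator
    gives that of [g_{-1}] ([gM_stable], [gM_stable_inv]). *)

(** * Brackets and automorphisms *)

Section Bracket.
Variables (K : comPzRingType) (L : lieAlgType K).
Implicit Types x y z : L.

Lemma lieDr x y z : lie x (y + z) = lie x y + lie x z.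
Proof. exact: (raddfD (ad x)). Qed.

Lemma lieNr x y : lie x (- y) = - lie x y.
Proof. exact: (raddfN (ad x)). Qed.

Lemma lie0r x : lie x 0 = 0.
Proof. exact: (raddf0 (ad x)). Qed.

Lemma lieZr a x y : lie x (a *: y) = a *: lie x y.
Proof. exact: (linearZ_LR (ad x)). Qed.

Lemma lieDl x y z : lie (x + y) z = lie x z + lie y z.
Proof. by rewrite lieN lieDr opprD -!lieN. Qed.

Lemma lieNl x y : lie (- x) y = - lie x y.
Proof. by rewrite lieN lieNr -lieN. Qed.

Lemma lie0l x : lie 0 x = 0.
Proof. by rewrite lieN lie0r oppr0. Qed.

Lemma lieZl a x y : lie (a *: x) y = a *: lie x y.
Proof. by rewrite lieN lieZr -scalerN -lieN. Qed.

Section Composition.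
Variables f g : lieAut L.

Lemma aut_comp_lie x y : (f \o g) (lie x y) = lie ((f \o g) x) ((f \o g) y).
Proof. by rewrite /= !aut_lie. Qed.

Definition lieAut_comp : lieAut L :=
  @LieAut K L (aut_fun f \o aut_fun g) (aut_inv_fun g \o aut_inv_fun f)
    (can_comp (aut_funK f) (aut_funK g))
    (can_comp (aut_inv_funK g) (aut_inv_funK f)) aut_comp_lie.

End Composition.

End Bracket.

Section Torsion.
Variables (K : comPzRingType) (V : lmodType K).

Lemma mulrn_inv_eq0 (a : K) (n : nat) (v : V) :
  a * n%:R = 1 -> v *+ n = 0 -> v = 0.
Proof. by move=> an vn; rewrite -(scale1r v) -an -scalerA scaler_nat vn scaler0. Qed.

Lemma half_double (a : K) (v : V) : a * 2%:R = 1 -> a *: v + a *: v = v.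
Proof. by move=> a2; rewrite -scalerDl -mulr2n -mulr_natr a2 scale1r. Qed.

Lemma eq_invertible (f g : {linear V -> V}) :
  f =1 g -> invertible f -> invertible g.
Proof.
move=> fg [f' [fK f'K]]; exists f'; split=> v; first by rewrite -fg fK.
by rewrite -fg f'K.
Qed.

End Torsion.

(** * The 3-grading *)

Section Flag.
Variables (K : comPzRingType) (half third : K).
Hypotheses (h2 : half * 2%:R = 1) (h3 : third * 3%:R = 1).
Variables (L : lieAlgType K) (E : L).
Hypothesis hE : euler_operator E.
Implicit Types (i j : degree) (X Y Z : L).

Local Notation "''g_' i" := (grade_pred E i) (at level 8, i at level 2).

Fact pr_key : unit. Proof. by []. Qed.

(** The projection onto [g_i], as an endomorphism of the whole algebra, so that
    graded components can be bracketed without casts.  It is locked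
    to keep additivity of the bracket from splitting the sums in the polynomials
    in [ad E] that define it. *)
Definition pr i : {linear L -> L} :=
  locked_with pr_key (val \o proj half hE i : {linear L -> L}).

Lemma prE i X : pr i X = val (proj half hE i X).
Proof. by rewrite /pr unlock. Qed.

Lemma pr_in i X : pr i X \in 'g_i.
Proof. by rewrite prE; exact: proj_in. Qed.

Lemma pr_grade i j X : X \in 'g_j -> pr i X =
  match i, j with P1, P1 | Z0, Z0 | M1, M1 => X | _, _ => 0 end.
Proof. by move=> Xj; rewrite prE; have := projE hE h2 i (Sub X Xj : grade E j). Qed.

Lemma pr_sum X : pr P1 X + pr Z0 X + pr M1 X = X.
Proof. by rewrite !prE; exact: sum_proj. Qed.

Lemma lie_in i j k X Y : int_of_degree k = int_of_degree i + int_of_degree j ->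
  X \in 'g_i -> Y \in 'g_j -> lie X Y \in 'g_k.
Proof. by move=> ijk Xi Yj; apply: (@lie_grade K L E i j k (Sub X Xi) (Sub Y Yj)). Qed.

Lemma lie_eigen (a b : int) X Y : lie E X = X *~ a -> lie E Y = Y *~ b ->
  lie E (lie X Y) = lie X Y *~ (a + b).
Proof.
move=> Xa Yb; rewrite lie_der Xa Yb mulrzDr; congr (_ + _).
  by rewrite lieN -[lie Y _]/(ad Y _) raddfMz /= /ad -mulNrz -lieN.
by rewrite -[LHS]/(ad X _) raddfMz.
Qed.

(** On such an [X] the relation [ad(E)^3 = ad(E)] reads [8 X = 2 X] up to sign, and
    [6] is invertible. *)
Lemma eigen2_eq0 X : lie E X = X *~ 2 \/ lie E X = X *~ -2 -> X = 0.
Proof.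
have h6 : (half * third) * 6%:R = 1.
  by rewrite (natrM _ 2 3) mulrACA h2 h3 mulr1.
move=> EX; apply: (mulrn_inv_eq0 h6).
have := hE X; rewrite /ad.
have lieMz (m : int) Y : lie E (Y *~ m) = lie E Y *~ m by exact: (raddfMz (ad E)).
case: EX => EX; rewrite !(EX, lieMz) -!mulrzA => /eqP;
  rewrite -subr_eq0 -mulrzBr => /eqP //.
by move=> e; apply/eqP; rewrite -oppr_eq0 -e.
Qed.

Lemma lie11 X Y : X \in 'g_P1 -> Y \in 'g_P1 -> lie X Y = 0.
Proof.
by move=> /gradeE X1 /gradeE Y1; apply: eigen2_eq0; left; rewrite (lie_eigen X1 Y1).
Qed.

Lemma lieMM X Y : X \in 'g_M1 -> Y \in 'g_M1 -> lie X Y = 0.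
Proof.
by move=> /gradeE X1 /gradeE Y1; apply: eigen2_eq0; right; rewrite (lie_eigen X1 Y1).
Qed.

Lemma pr_sum0M X : pr P1 X = 0 -> X = pr Z0 X + pr M1 X.
Proof. by move=> X1; rewrite -{1}(pr_sum X) X1 add0r. Qed.

(** There is no term of degree [2] or [-2], because [g_1] and [g_{-1}] are abelian. *)
Lemma pr_lie X Y :
  [/\ pr P1 (lie X Y) = lie (pr P1 X) (pr Z0 Y) + lie (pr Z0 X) (pr P1 Y),
      pr Z0 (lie X Y) = lie (pr P1 X) (pr M1 Y) + lie (pr Z0 X) (pr Z0 Y)
                        + lie (pr M1 X) (pr P1 Y)
    & pr M1 (lie X Y) = lie (pr Z0 X) (pr M1 Y) + lie (pr M1 X) (pr Z0 Y)].
Proof.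
have e : lie X Y =
    (lie (pr P1 X) (pr Z0 Y) + lie (pr Z0 X) (pr P1 Y))
  + (lie (pr P1 X) (pr M1 Y) + lie (pr Z0 X) (pr Z0 Y) + lie (pr M1 X) (pr P1 Y))
  + (lie (pr Z0 X) (pr M1 Y) + lie (pr M1 X) (pr Z0 Y)).
  rewrite -{1}(pr_sum X) -{1}(pr_sum Y) !(lieDl, lieDr).
  rewrite (lie11 (pr_in P1 X) (pr_in P1 Y)) (lieMM (pr_in M1 X) (pr_in M1 Y)).
  rewrite add0r addr0 !addrA.
  by rewrite [LHS](AC 7 (1*3*2*4*6*5*7)).
have in1 : lie (pr P1 X) (pr Z0 Y) + lie (pr Z0 X) (pr P1 Y) \in 'g_P1.
  by apply: rpredD; [apply: (@lie_in P1 Z0 P1)|apply: (@lie_in Z0 P1 P1)];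
    rewrite ?pr_in.
have in0 : lie (pr P1 X) (pr M1 Y) + lie (pr Z0 X) (pr Z0 Y)
  + lie (pr M1 X) (pr P1 Y) \in 'g_Z0.
  by apply: rpredD; [apply: rpredD|]; [apply: (@lie_in P1 M1 Z0)
    |apply: (@lie_in Z0 Z0 Z0)|apply: (@lie_in M1 P1 Z0)]; rewrite ?pr_in.
have inM : lie (pr Z0 X) (pr M1 Y) + lie (pr M1 X) (pr Z0 Y) \in 'g_M1.
  by apply: rpredD; [apply: (@lie_in Z0 M1 M1)|apply: (@lie_in M1 Z0 M1)];
    rewrite ?pr_in.
rewrite e; split; rewrite [LHS]raddfD [X in X + _]raddfD /=;
  by rewrite (pr_grade _ in1) (pr_grade _ in0) (pr_grade _ inM) ?(addr0, add0r).
Qed.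

Lemma lie_euler_pr X i : lie E (pr i X) = pr i X *~ int_of_degree i.
Proof. exact: gradeE (pr_in i X). Qed.

(** * The stabilizer of the flag *)

(** Membership in [p = g_0 + g_{-1}] is expressed as the vanishing of the component
    of degree [1], which is how it is tested below. *)
Definition stabilizes_flag (f : L -> L) : Prop :=
  (forall X, X \in 'g_M1 -> f X \in 'g_M1) /\
  (forall X, pr P1 X = 0 -> pr P1 (f X) = 0).

Lemma mem_flag_minus2 X : (flag_minus E).2 X <-> pr P1 X = 0.
Proof.
split=> [[Y Y0 [Z ZM <-]]|X1].
  by rewrite raddfD /= (pr_grade P1 Y0) (pr_grade P1 ZM) addr0.
by exists (pr Z0 X); [exact: pr_in|exists (pr M1 X); [exact: pr_in|rewrite -pr_sum0M]].
Qed.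

Lemma image_fixP (T : Type) (f f' : T -> T) (A : set T) :
  cancel f f' -> cancel f' f ->
  (f @` A)%classic = A <->
  (forall t, A t -> A (f t)) /\ (forall t, A t -> A (f' t)).
Proof.
move=> fK f'K; split=> [fA|[Af Af']].
  split=> t At; first by rewrite -fA; exists t.
  by move: At; rewrite -{1}fA => -[u Au <-]; rewrite fK.
apply/seteqP; split=> [_ [t At <-]|t At]; first exact: Af.
by exists (f' t); [exact: Af'|rewrite f'K].
Qed.

Lemma flag_act_comp (f f' : {linear L -> L}) (F : flag L) :
  flag_act f (flag_act f' F) = flag_act (f \o f') F.
Proof. by rewrite /flag_act /= !image_comp. Qed.

Lemma flag_actK (f f' : {linear L -> L}) :
  cancel f f' -> cancel (flag_act f) (flag_act f').
Proof.
move=> fK [A B]; rewrite flag_act_comp /flag_act /=; congr (_, _);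
  by rewrite -[RHS]image_id; apply: eq_imagel => X _ /=; rewrite fK.
Qed.

Lemma flag_act_fixP (k : lieAut L) :
  flag_act k (flag_minus E) = flag_minus E <->
  stabilizes_flag k /\ stabilizes_flag (lieAut_inv k).
Proof.
have e1 := image_fixP (flag_minus E).1 (aut_funK k) (aut_inv_funK k).
have e2 := image_fixP (flag_minus E).2 (aut_funK k) (aut_inv_funK k).
split=> [[/e1 [k1 l1] /e2 [k2 l2]]|[[k1 k2] [l1 l2]]].
  by split; split=> // X /mem_flag_minus2 X2; apply/mem_flag_minus2; [exact: k2|exact: l2].
rewrite /flag_act [RHS]surjective_pairing; congr (_, _).
  by apply/e1; split.
by apply/e2; split=> X /mem_flag_minus2 X2; apply/mem_flag_minus2; [exact: k2|exact: l2].
Qed.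

Lemma val_component i j (f : {linear L -> L}) (X : grade E j) :
  val (component half hE i j f X) = pr i (f (val X)).
Proof. by rewrite prE. Qed.

(** A map preserving [p] induces a map of the quotient [g / p], which the component
    of degree [1] identifies with [g_1]. *)
Lemma pr1_triangular (f : {linear L -> L}) :
  (forall X, pr P1 X = 0 -> pr P1 (f X) = 0) ->
  forall X, pr P1 (f X) = pr P1 (f (pr P1 X)).
Proof.
move=> fp X; have /fp : pr P1 (X - pr P1 X) = 0.
  by rewrite raddfB /= (pr_grade P1 (pr_in P1 X)) subrr.
by rewrite [f _]raddfB [LHS]raddfB => /eqP; rewrite subr_eq0 => /eqP.
Qed.

Lemma component11_cancel (f f' : {linear L -> L}) :
  cancel f f' -> stabilizes_flag f' ->
  cancel (component half hE P1 P1 f) (component half hE P1 P1 f').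
Proof.
move=> fK [_ f'p] X; apply: val_inj; rewrite !val_component.
by rewrite -pr1_triangular // fK (pr_grade P1 (valP X)).
Qed.

Lemma componentMM_cancel (f f' : {linear L -> L}) :
  cancel f f' -> stabilizes_flag f ->
  cancel (component half hE M1 M1 f) (component half hE M1 M1 f').
Proof.
move=> fK [fM _] X; apply: val_inj; rewrite !val_component.
by rewrite (pr_grade M1 (fM _ (valP X))) fK (pr_grade M1 (valP X)).
Qed.

(** Let [A] be the component of degree [0] of [k E].  As [k E] lies in [p], bracketing
    with it acts on [g / p = g_1] through [ad A].  Elements of [k g_1] are fixed by
    [ad (k E)] and cover [g / p], so [ad A] is the identity of [g_1].  Hence an
    element of [k g_i] with [i <> 1], being an eigenvector of [ad (k E)] for an
    eigenvalue other than [1], has no component in degree [1]; the difference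
    between the eigenvalues [1] and [-1] is [2], which is invertible. *)
Lemma parabolic_stable (k : lieAut L) :
  pr P1 (k E) = 0 -> invertible (component half hE P1 P1 k) ->
  forall X, pr P1 X = 0 -> pr P1 (k X) = 0.
Proof.
move=> kE1 [d' [_ d'K]].
have ad0 X : lie (pr Z0 (k E)) (pr P1 (k X)) = pr P1 (k (lie E X)).
  by rewrite aut_lie; have [-> _ _] := pr_lie (k E) (k X); rewrite kE1 lie0l add0r.
have ad1 Y : Y \in 'g_P1 -> lie (pr Z0 (k E)) Y = Y.
  move=> Y1; pose Y' : grade E P1 := Sub Y Y1.
  rewrite -[Y]/(val Y') -(d'K Y') val_component ad0.
  by rewrite (gradeE (valP (d' Y'))) mulr1z.
move=> X X1; rewrite (pr_sum0M X1) raddfD [LHS]raddfD /=.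
have -> : pr P1 (k (pr Z0 X)) = 0.
  by rewrite -(ad1 _ (pr_in _ _)) ad0 lie_euler_pr mulr0z !raddf0.
rewrite add0r; apply: (mulrn_inv_eq0 h2); rewrite mulr2n.
by rewrite -{1}(ad1 _ (pr_in _ _)) ad0 lie_euler_pr mulrN1z !raddfN addNr.
Qed.

Lemma parabolic_stable_inv (k : lieAut L) :
  (forall X, pr P1 X = 0 -> pr P1 (k X) = 0) ->
  invertible (component half hE P1 P1 k) ->
  forall X, pr P1 X = 0 -> pr P1 (lieAut_inv k X) = 0.
Proof.
move=> kp [d' [dK _]] X X1.
suff Y1 : proj half hE P1 (lieAut_inv k X) = 0 by rewrite prE Y1.
apply: (can_inj dK); rewrite raddf0; apply: val_inj; rewrite val_component -prE.
by rewrite -pr1_triangular //= aut_inv_funK X1.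
Qed.

(** For [Y] in [g_{-1}], write [k Y = u + c Y] with [u] in [g_0] and [c Y] in
    [g_{-1}]; the goal is [u = 0].  Write also [k E = B + v], with [v = c V] for some
    [V] in [g_{-1}] because [c] is surjective, and subtract from [B] the element
    [u_V] attached to [V].  The images of [[E, Y] = - Y] and of [[V, Y] = 0] under
    [k] show that [B - u_V] acts as [-1] on all the [u] and on [c(g_{-1}) = g_{-1}].
    By the Leibniz rule it multiplies [[v, u]] by [-2], but also by [-1] since
    [[v, u]] lies in [g_{-1}]; so [[v, u] = 0].  Then [[k E, u] = [B, u] = - u], that is, [u = k Y'] for some
    [Y'] in [g_{-1}].  As [u] has no component in [g_{-1}], [c Y' = 0] and so
    [Y' = 0]. *)
Lemma gM_stable (k : lieAut L) :
  (forall X, pr P1 X = 0 -> pr P1 (k X) = 0) ->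
  invertible (component half hE M1 M1 k) ->
  forall X, X \in 'g_M1 -> k X \in 'g_M1.
Proof.
move=> kp [c' [cK c'K]] X XM.
have kM Y : Y \in 'g_M1 -> pr P1 (k Y) = 0.
  by move=> YM; rewrite kp // (pr_grade P1 YM).
have c_surj Z : Z \in 'g_M1 -> exists2 Y, Y \in 'g_M1 & pr M1 (k Y) = Z.
  move=> ZM; exists (val (c' (Sub Z ZM))); first exact: valP.
  by rewrite -val_component c'K.
have c_inj Y : Y \in 'g_M1 -> pr M1 (k Y) = 0 -> Y = 0.
  move=> YM Y0; suff /(congr1 val) : (Sub Y YM : grade E M1) = 0 by [].
  by apply: (can_inj cK); rewrite raddf0; apply: val_inj; rewrite val_component.
have E1 : pr P1 (k E) = 0 by rewrite kp // (pr_grade P1 (euler_in_g0 E)).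
have kEY Y : Y \in 'g_M1 -> lie (k E) (k Y) = - k Y.
  by move=> YM; rewrite -aut_lie (gradeE YM) mulrN1z raddfN.
have Bu Y : Y \in 'g_M1 ->
    lie (pr Z0 (k E)) (pr Z0 (k Y)) = - pr Z0 (k Y).
  move=> YM; have := congr1 (pr Z0) (kEY Y YM).
  have [_ -> _] := pr_lie (k E) (k Y).
  by rewrite E1 (kM Y YM) lie0l lie0r add0r addr0 [RHS]raddfN.
have Bc Y : Y \in 'g_M1 ->
    lie (pr Z0 (k E)) (pr M1 (k Y)) + lie (pr M1 (k E)) (pr Z0 (k Y))
    = - pr M1 (k Y).
  move=> YM; have := congr1 (pr M1) (kEY Y YM).
  by have [_ _ ->] := pr_lie (k E) (k Y); rewrite [RHS]raddfN.
have kYY Y Z : Y \in 'g_M1 -> Z \in 'g_M1 -> lie (k Y) (k Z) = 0.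
  by move=> YM ZM; rewrite -aut_lie (lieMM YM ZM) raddf0.
have uu Y Z : Y \in 'g_M1 -> Z \in 'g_M1 ->
    lie (pr Z0 (k Y)) (pr Z0 (k Z)) = 0.
  move=> YM ZM; have := congr1 (pr Z0) (kYY Y Z YM ZM).
  have [_ -> _] := pr_lie (k Y) (k Z).
  by rewrite (kM Y YM) (kM Z ZM) lie0l lie0r add0r addr0 raddf0.
have uc Y Z : Y \in 'g_M1 -> Z \in 'g_M1 ->
    lie (pr Z0 (k Y)) (pr M1 (k Z)) = - lie (pr M1 (k Y)) (pr Z0 (k Z)).
  move=> YM ZM; have := congr1 (pr M1) (kYY Y Z YM ZM).
  have [_ _ ->] := pr_lie (k Y) (k Z).
  by rewrite raddf0 => /eqP; rewrite addr_eq0 => /eqP.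
have [V VM cV] := c_surj _ (pr_in M1 (k E)).
(* By uc, the term [v, u] of Bc is - [u_V, c Y]: the shift by - u_V absorbs it. *)
pose B := pr Z0 (k E) - pr Z0 (k V).
have B_u Y : Y \in 'g_M1 -> lie B (pr Z0 (k Y)) = - pr Z0 (k Y).
  by move=> YM; rewrite lieDl lieNl Bu // uu // subr0.
have B_M Z : Z \in 'g_M1 -> lie B Z = - Z.
  move=> ZM; have [Y YM <-] := c_surj Z ZM.
  by rewrite lieDl lieNl (uc V) // opprK cV Bc.
have vu : lie (pr M1 (k E)) (pr Z0 (k X)) = 0.
  have inM : lie (pr M1 (k E)) (pr Z0 (k X)) \in 'g_M1.
    by apply: (@lie_in M1 Z0 M1); rewrite ?pr_in.
  have := B_M _ inM; rewrite lie_der B_u // B_M ?pr_in // lieNl lieNr.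
  move=> /eqP; rewrite -subr_eq0 opprK addrNK oppr_eq0 => /eqP //.
have ku : aut_inv_fun k (pr Z0 (k X)) \in 'g_M1.
  rewrite unfold_in /grade_pred; apply/eqP.
  apply: (can_inj (aut_funK k)); rewrite aut_lie aut_inv_funK mulrN1z raddfN /=.
  rewrite aut_inv_funK (pr_sum0M E1) lieDl vu addr0; exact: Bu.
have u0 : pr Z0 (k X) = 0.
  rewrite -(aut_inv_funK k (pr Z0 (k X))) (_ : aut_inv_fun k _ = 0) ?raddf0 //.
  apply: c_inj => //.
  by rewrite aut_inv_funK (pr_grade M1 (pr_in Z0 _)).
by rewrite (pr_sum0M (kM X XM)) u0 add0r pr_in.
Qed.

Lemma gM_stable_inv (k : lieAut L) :
  (forall X, X \in 'g_M1 -> k X \in 'g_M1) ->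
  invertible (component half hE M1 M1 k) ->
  forall X, X \in 'g_M1 -> lieAut_inv k X \in 'g_M1.
Proof.
move=> kM [c' [_ c'K]] X XM; pose Y := c' (Sub X XM).
have <- : k (val Y) = X.
  by rewrite -(pr_grade M1 (kM _ (valP Y))) -val_component c'K.
by rewrite /= aut_funK (valP Y).
Qed.

(** * Exponentials *)

Lemma ad2_in x X : x \in 'g_P1 -> lie x (lie x X) \in 'g_P1.
Proof.
move=> x1; rewrite -(pr_sum X) !lieDr (lie11 x1 (pr_in P1 X)) lie0r add0r.
have x0 : lie x (pr Z0 X) \in 'g_P1 by apply: (@lie_in P1 Z0 P1); rewrite ?pr_in.
rewrite (lie11 x1 x0) add0r.
by apply: (@lie_in P1 Z0 P1) => //; apply: (@lie_in P1 M1 Z0); rewrite ?pr_in.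
Qed.

Lemma ad3_eq0 x X : x \in 'g_P1 -> lie x (lie x (lie x X)) = 0.
Proof. by move=> x1; rewrite lie11 ?ad2_in. Qed.

Lemma expadE x X : expad half x X = X + lie x X + half *: lie x (lie x X).
Proof. by []. Qed.

Lemma expadK x : x \in 'g_P1 -> cancel (expad half x) (expad half (- x)).
Proof.
move=> x1 X; rewrite !expadE !(lieNl, lieNr, opprK) !(lieDr, lieZr).
rewrite !ad3_eq0 // !lie0r !scaler0 !addr0.
rewrite -{2}(half_double (lie x (lie x X)) h2) !opprD !addrA.
by rewrite [LHS](ACl (1*(2*4)*(3*5)*(6*7))) /= !subrr addNr !addr0.
Qed.

Lemma expadNK x : x \in 'g_P1 -> cancel (expad half (- x)) (expad half x).
Proof. by move=> x1 X; have := @expadK (- x); rewrite opprK rpredN => ->. Qed.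

(** With [D = ad x], a derivation, both sides agree up to order 2 in [x].  On the
    right, the term of order 4 is a multiple of [[D^2 X, D^2 Y]], which vanishes
    since [D^2] takes values in the abelian [g_1]; the term of order 3 is half of
    [[D X, D^2 Y] + [D^2 X, D Y]], which vanishes because three times this sum is
    [D^3 [X, Y] = 0], by the Leibniz rule and [D^3 = 0]. *)
Lemma expad_lie x X Y : x \in 'g_P1 ->
  expad half x (lie X Y) = lie (expad half x X) (expad half x Y).
Proof.
move=> x1.
have D2 Z T : lie x (lie x (lie Z T)) =
    lie (lie x (lie x Z)) T + (lie (lie x Z) (lie x T) + lie (lie x Z) (lie x T))
    + lie Z (lie x (lie x T)).
  by rewrite (lie_der x Z T) lieDr (lie_der x (lie x Z)) (lie_der x Z) !addrA.
have s0 : lie (lie x X) (lie x (lie x Y)) + lie (lie x (lie x X)) (lie x Y) = 0.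
  apply: (mulrn_inv_eq0 h3); have := ad3_eq0 (lie X Y) x1.
  rewrite (lie_der x X Y) !lieDr (D2 (lie x X) Y) (D2 X (lie x Y)) !ad3_eq0 //
    lie0l lie0r addr0 add0r => e.
  rewrite -[RHS]e mulrSr mulr2n !addrA.
  by rewrite [RHS](ACl (3*1*5*2*6*4)).
rewrite !expadE (D2 X Y) (lie_der x X Y) !(lieDl, lieDr, lieZl, lieZr).
rewrite (lie11 (ad2_in X x1) (ad2_in Y x1)) !scaler0 addr0.
rewrite !scalerDr (half_double _ h2).
have {s0} /eqP := congr1 ( *:%R half) s0.
rewrite scalerDr scaler0 addr_eq0 => /eqP ->.
by rewrite !addrA [RHS](ACl (1*4*2*7*5*3*(6*8))) /= addNr addr0.
Qed.

Definition expAut x (x1 : x \in 'g_P1) : lieAut L :=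
  LieAut (expadK x1) (expadNK x1) (fun X Y => expad_lie X Y x1).

(** * Denominators and the action on flags *)

Section Normalized.
Variables (g : lieAut L) (x z : Vplus E).

(** [e^{-z} g e^x]: it turns the equation [g.x = z] into a statement about the
    stabilizer of the base flag. *)
Definition normalized : lieAut L :=
  lieAut_comp (lieAut_inv (expAut (valP z)))
    (lieAut_comp g (expAut (valP x))).

Lemma moves_toP : moves_to half g x z <->
  stabilizes_flag normalized /\ stabilizes_flag (lieAut_inv normalized).
Proof.
rewrite -flag_act_fixP /moves_to /moved_flag.
have -> : flag_act normalized (flag_minus E) =
    flag_act (expad half (- val z))
      (flag_act g (flag_act (expad half (val x)) (flag_minus E))).
  by rewrite !flag_act_comp.
split=> [->|e]; first by rewrite flag_actK //; exact: expadK (valP z).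
apply: (can_inj (flag_actK (expadNK (valP z)))).
by rewrite e flag_actK //; exact: expadK (valP z).
Qed.

Lemma expad_g1 X (y : Vplus E) : X \in 'g_P1 -> expad half (val y) X = X.
Proof.
by move=> X1; rewrite expadE !(lie11 (valP y) X1) lie0r scaler0 !addr0.
Qed.

Lemma denominator_normalized :
  component half hE P1 P1 (lieAut_inv normalized) =1 denominator half hE g x.
Proof.
move=> Y; apply: val_inj; rewrite !val_component.
rewrite -[LHS]/(pr P1 (expad half (- val x)
  (lieAut_inv g (expad half (val z) (val Y))))).
by rewrite (expad_g1 z (valP Y)).
Qed.

Lemma codenominator_normalized :
  component half hE M1 M1 normalized =1 codenominator half hE g x.
Proof.
move=> Y; apply: val_inj; rewrite !val_component.
rewrite -[LHS]/(pr M1 (expad half (- val z) (g (expad half (val x) (val Y))))).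
rewrite -[RHS]/(pr M1 (g (expad half (val x) (val Y)))).
set X := g _; have z1 : - val z \in 'g_P1 by rewrite rpredN (valP z).
rewrite expadE !linearD linearZ /=.
rewrite (pr_grade M1 (ad2_in X z1)) scaler0 addr0.
have [_ _ ->] := pr_lie (- val z) X.
by rewrite (pr_grade Z0 z1) (pr_grade M1 z1) !lie0l !addr0.
Qed.

Lemma nominator_normalized :
  pr P1 (lieAut_inv normalized E) =
  val (nominator half hE g x - denominator half hE g x z).
Proof.
pose f := expad half (- val x) \o lieAut_inv g.
have nE : val (nominator half hE g x) = pr P1 (f E) by rewrite prE.
have dz : val (denominator half hE g x z) = pr P1 (f (val z)) by rewrite prE.
transitivity (val (nominator half hE g x) - val (denominator half hE g x z));
  last by rewrite raddfB.
rewrite nE dz -linearB -[f E - _]linearB.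
rewrite -[LHS]/(pr P1 (f (expad half (val z) E))).
have -> : expad half (val z) E = E - val z.
  rewrite expadE lieN (gradeE (valP z)) mulr1z lieNr (lie11 (valP z) (valP z)).
  by rewrite oppr0 scaler0 addr0.
by [].
Qed.

Lemma moves_to_value : moves_to half g x z ->
  invertible (codenominator half hE g x) /\
  exists2 dinv : {linear grade E P1 -> grade E P1},
    is_inverse (denominator half hE g x) dinv &
    z = dinv (nominator half hE g x).
Proof.
move=> /moves_toP [k_stab l_stab]; split.
  apply: (eq_invertible codenominator_normalized).
  exists (component half hE M1 M1 (lieAut_inv normalized)); split.
    by apply: componentMM_cancel => //; exact: aut_funK.
  by apply: componentMM_cancel => //; exact: aut_inv_funK.
exists (component half hE P1 P1 normalized).
  split=> Y.
    rewrite -denominator_normalized; apply: component11_cancel => //.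
    exact: aut_inv_funK.
  rewrite -denominator_normalized; apply: component11_cancel => //.
  exact: aut_funK.
have /eqP : nominator half hE g x - denominator half hE g x z = 0.
  apply: val_inj; rewrite -nominator_normalized; apply: (proj2 l_stab).
  exact: pr_grade (euler_in_g0 E).
rewrite subr_eq0 => /eqP ->; rewrite -denominator_normalized.
by rewrite component11_cancel //; exact: aut_inv_funK.
Qed.

Lemma moves_to_of_value (dinv : {linear grade E P1 -> grade E P1}) :
  is_inverse (denominator half hE g x) dinv ->
  invertible (codenominator half hE g x) ->
  z = dinv (nominator half hE g x) ->
  moves_to half g x z.
Proof.
move=> dK inv_c zE; apply/moves_toP.
have inv_l : invertible (component half hE P1 P1 (lieAut_inv normalized)).
  apply: (@eq_invertible _ _ (denominator half hE g x)); last by exists dinv.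
  exact: fsym denominator_normalized.
have {}inv_c : invertible (component half hE M1 M1 normalized).
  exact: eq_invertible (fsym codenominator_normalized) inv_c.
have lE : pr P1 (lieAut_inv normalized E) = 0.
  by rewrite nominator_normalized zE (proj2 dK) subrr.
have lp := parabolic_stable lE inv_l.
have kp X : pr P1 X = 0 -> pr P1 (normalized X) = 0.
  exact: (parabolic_stable_inv lp inv_l).
have kM := gM_stable kp inv_c.
have lM := gM_stable_inv kM inv_c.
by split; split.
Qed.

End Normalized.

Lemma in_VplusP (g : lieAut L) (x : Vplus E) :
  in_Vplus half g x <-> invertible (denominator half hE g x) /\
                        invertible (codenominator half hE g x).
Proof.
split=> [[z /moves_to_value [inv_c [dinv dK _]]]|[[dinv dK] inv_c]].
  by split=> //; exists dinv.
by exists (dinv (nominator half hE g x)); exact: (moves_to_of_value dK inv_c).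
Qed.

(** The top row of the matrix of [e^{-x}], which expands the denominator and the
    nominator into the blocks of [g]. *)
Lemma pr1_expad (x : Vplus E) Y :
  proj half hE P1 (expad half (- val x) Y) =
  proj half hE P1 Y - ad_0to1 x (proj half hE Z0 Y)
    + half *: ad_0to1 x (ad_m1to0 x (proj half hE M1 Y)).
Proof.
apply: val_inj; rewrite -prE.
transitivity (pr P1 Y - lie (val x) (pr Z0 Y)
    + half *: lie (val x) (lie (val x) (pr M1 Y))); last by rewrite !prE.
rewrite expadE !(lieNl, lieNr, opprK) !linearD linearN linearZ /=.
have x1 := pr_grade _ (valP x).
have [-> _ _] := pr_lie (val x) Y.
have [-> _ _] := pr_lie (val x) (lie (val x) Y).
have [_ -> _] := pr_lie (val x) Y.
by rewrite !(x1 P1) !(x1 Z0) !(x1 M1) !lie0l !addr0.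
Qed.

End Flag.

Theorem theorem2p8 (K : comPzRingType) (half third : K)
    (h2 : half * 2%:R = 1) (h3 : third * 3%:R = 1)
    (L : lieAlgType K) (E : L) (hE : euler_operator E) :
  (forall (g : lieAut L) (x : Vplus E),
     (in_Vplus half g x <->
        invertible (denominator half hE g x) /\
        invertible (codenominator half hE g x)) /\
     (forall z : Vplus E, moves_to half g x z ->
        exists2 dinv : {linear grade E P1 -> grade E P1},
          is_inverse (denominator half hE g x) dinv &
          z = dinv (nominator half hE g x))) /\
  (forall (g : lieAut L) (x z : Vplus E),
     let c i j := component half hE i j g in
     moves_to half (lieAut_inv g) x z ->
     exists2 dinv : {linear grade E P1 -> grade E P1},
       is_inverse
         (c P1 P1 \- (ad_0to1 x \o c Z0 P1)
            \+ (half \*: (ad_0to1 x \o ad_m1to0 x \o c M1 P1))) dinv &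
       z = dinv ((c P1 Z0 \- (ad_0to1 x \o c Z0 Z0)
                    \+ (half \*: (ad_0to1 x \o ad_m1to0 x \o c M1 Z0)))
                   (euler0 E))).
Proof.
split=> [g x|g x z c].
  split; first exact: (in_VplusP h2 h3).
  by move=> z /(moves_to_value h2 h3 hE) [].
move=> /(moves_to_value h2 h3 hE) [_ [dinv [dK d'K] ->]].
exists dinv; last by congr (dinv _); exact: (pr1_expad h2 h3 hE x (g E)).
set D := (D in is_inverse D _).
have DE Y : D Y = denominator half hE (lieAut_inv g) x Y.
  exact: esym (pr1_expad h2 h3 hE x (g (val Y))).
by split=> Y; rewrite DE.
Qed.
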